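(* The category $\mathbf{QAb}$ of abelian qo-groups is monadic over the category $\mathbf{Set}^m$ of set monomorphisms.
   Context: A quasi-order is a reflexive and transitive relation. An abelian quasi-ordered group (abelian qo-group) $(G,\preceq)$ is an abelian group $G$, written additively, with a quasi-order $\preceq$ that is translation invariant: $a\preceq b$ implies $a+c\preceq b+c$ for all $c\in G$. $\mathbf{QAb}$ is the category of abelian qo-groups with order-preserving group homomorphisms. $\mathbf{Set}^m$ is the category whose objects are injective set maps $i:X'\to X$ and whose morphisms $(i:X'\to X)\to(j:Y'\to Y)$ are pairs $(f_1,f_2)$ of set maps $f_1:X\to Y$, $f_2:X'\to Y'$ with $j\circ f_2=f_1\circ i$, composed componentwise. An adjunction $(F,U,\eta,\varepsilon)$ with left adjoint $F:\mathbf{C}\to\mathbf{D}$ and right adjoint $U:\mathbf{D}\to\mathbf{C}$ gives a monad $T=(UF,\eta,U\varepsilon F)$ on $\mathbf{C}$. The adjunction is called monadic if the comparison functor from $\mathbf{D}$ to the Eilenberg-Moore category $\mathbf{C}^T$ of $T$-algebras is an equivalence of categories. A category $\mathbf{D}$ is monadic over $\mathbf{C}$ if there is a monadic adjunction with left adjoint $\mathbf{C}\to\mathbf{D}$ and right adjoint $\mathbf{D}\to\mathbf{C}$. *)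

(* Defs.v *)
From HB Require Import structures.
From mathcomp Require Import all_boot all_algebra.
From mathcomp Require Import boolp.

Set Implicit Arguments.
Unset Strict Implicit.
Unset Printing Implicit Defensive.
Import GRing.Theory.
Local Open Scope ring_scope.

Declare Scope cat_scope.
Delimit Scope cat_scope with cat.
Local Open Scope cat_scope.

(* Morphisms are compared with Leibniz equality, which is extensional equality
   in the concrete categories below by functional and propositional
   extensionality. *)
Record category := Category {
  obj :> Type;
  hom : obj -> obj -> Type;
  idm : forall a, hom a a;
  comp : forall a b c, hom b c -> hom a b -> hom a c;
  compmA : forall a b c d (h : hom c d) (g : hom b c) (f : hom a b),
    comp h (comp g f) = comp (comp h g) f;
  comp1m : forall a b (f : hom a b), comp (idm b) f = f;
  compm1 : forall a b (f : hom a b), comp f (idm a) = f }.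

Arguments idm {C} a : rename.
Arguments comp {C a b c} g f : rename.
Notation "g \c f" := (comp g f) (at level 40, left associativity) : cat_scope.

Definition is_iso (C : category) (a b : C) (f : hom a b) : Prop :=
  exists g : hom b a, g \c f = idm a /\ f \c g = idm b.

Record functor (C D : category) := Functor {
  fobj :> C -> D;
  fmap : forall a b, hom a b -> hom (fobj a) (fobj b);
  fmap1 : forall a, fmap (idm a) = idm (fobj a);
  fmapM : forall a b c (g : hom b c) (f : hom a b),
    fmap (g \c f) = fmap g \c fmap f }.

Arguments fmap {C D} F {a b} f : rename.

Definition id_functor (C : category) : functor C C :=
  @Functor C C id (fun _ _ => id) (fun _ => erefl) (fun _ _ _ _ _ => erefl).

Section FunctorComposition.
Variables (C D E : category) (G : functor D E) (F : functor C D).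

Lemma functor_comp1 (a : C) : fmap G (fmap F (idm a)) = idm (G (F a)).
Proof. by rewrite !fmap1. Qed.

Lemma functor_compM (a b c : C) (g : hom b c) (f : hom a b) :
  fmap G (fmap F (g \c f)) = fmap G (fmap F g) \c fmap G (fmap F f).
Proof. by rewrite !fmapM. Qed.

Definition functor_comp : functor C E :=
  @Functor C E (fun a => G (F a)) (fun a b f => fmap G (fmap F f))
    functor_comp1 functor_compM.

End FunctorComposition.

Notation "G \F F" := (functor_comp G F)
  (at level 40, left associativity) : cat_scope.

Record nat_trans (C D : category) (F G : functor C D) := NatTrans {
  component :> forall a : C, hom (F a) (G a);
  naturality : forall (a b : C) (f : hom a b),
    fmap G f \c component a = component b \c fmap F f }.

Definition nat_isomorphic (C D : category) (F G : functor C D) : Prop :=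
  exists phi : nat_trans F G, forall a, is_iso (phi a).

Definition is_equivalence (C D : category) (F : functor C D) : Prop :=
  exists G : functor D C,
    nat_isomorphic (G \F F) (id_functor C) /\
    nat_isomorphic (F \F G) (id_functor D).

Record adjunction (C D : category) := Adjunction {
  ladj : functor C D;
  radj : functor D C;
  unit_adj : nat_trans (id_functor C) (radj \F ladj);
  counit_adj : nat_trans (ladj \F radj) (id_functor D);
  triangle_ladj : forall c : C,
    counit_adj (ladj c) \c fmap ladj (unit_adj c) = idm (ladj c);
  triangle_radj : forall d : D,
    fmap radj (counit_adj d) \c unit_adj (radj d) = idm (radj d) }.

Record monad (C : category) := Monad {
  mfun :> functor C C;
  ret : nat_trans (id_functor C) mfun;
  join : nat_trans (mfun \F mfun) mfun;
  join_retl : forall a : C, join a \c ret (mfun a) = idm (mfun a);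
  join_retr : forall a : C, join a \c fmap mfun (ret a) = idm (mfun a);
  joinA : forall a : C, join a \c fmap mfun (join a) = join a \c join (mfun a) }.

Arguments ret {C} T : rename.
Arguments join {C} T : rename.

Section EilenbergMoore.
Variables (C : category) (T : monad C).

Record algebra := Algebra {
  alg_obj :> C;
  alg_act : hom (T alg_obj) alg_obj;
  alg_unit : alg_act \c ret T alg_obj = idm alg_obj;
  alg_mult : alg_act \c join T alg_obj = alg_act \c fmap T alg_act }.

Record alg_hom (A B : algebra) := AlgHom {
  alg_map :> hom A B;
  alg_mapP : alg_map \c alg_act A = alg_act B \c fmap T alg_map }.

Lemma alg_hom_inj (A B : algebra) (f g : alg_hom A B) :
  alg_map f = alg_map g -> f = g.
Proof.
by case: f g => [f fP] [g gP] /= fg; subst g; rewrite (Prop_irrelevance fP gP).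
Qed.

Lemma alg_idP (A : algebra) :
  idm A \c alg_act A = alg_act A \c fmap T (idm A).
Proof. by rewrite fmap1 comp1m compm1. Qed.

Definition alg_id (A : algebra) : alg_hom A A := AlgHom (alg_idP A).

Lemma alg_compP (A B D : algebra) (g : alg_hom B D) (f : alg_hom A B) :
  (g \c f) \c alg_act A = alg_act D \c fmap T (g \c f).
Proof. by rewrite fmapM -compmA alg_mapP compmA alg_mapP -compmA. Qed.

Definition alg_comp (A B D : algebra) (g : alg_hom B D) (f : alg_hom A B) :
  alg_hom A D := AlgHom (alg_compP g f).

Lemma alg_compA (A B D E : algebra)
    (h : alg_hom D E) (g : alg_hom B D) (f : alg_hom A B) :
  alg_comp h (alg_comp g f) = alg_comp (alg_comp h g) f.
Proof. by apply: alg_hom_inj; exact: compmA. Qed.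

Lemma alg_comp1m (A B : algebra) (f : alg_hom A B) : alg_comp (alg_id B) f = f.
Proof. by apply: alg_hom_inj; exact: comp1m. Qed.

Lemma alg_compm1 (A B : algebra) (f : alg_hom A B) : alg_comp f (alg_id A) = f.
Proof. by apply: alg_hom_inj; exact: compm1. Qed.

Definition EM_category : category :=
  @Category algebra alg_hom alg_id alg_comp alg_compA alg_comp1m alg_compm1.

End EilenbergMoore.

Section Comparison.
Variables (C D : category) (A : adjunction C D).
Local Notation F := (ladj A).
Local Notation U := (radj A).
Local Notation eta := (unit_adj A).
Local Notation eps := (counit_adj A).

Lemma adj_join_nat (a b : C) (f : hom a b) :
  fmap (U \F F) f \c fmap U (eps (F a)) =
  fmap U (eps (F b)) \c fmap ((U \F F) \F (U \F F)) f.
Proof. by rewrite /= -!fmapM; congr fmap; exact: (naturality eps (fmap F f)). Qed.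

Definition adj_join : nat_trans ((U \F F) \F (U \F F)) (U \F F) :=
  @NatTrans _ _ ((U \F F) \F (U \F F)) (U \F F)
    (fun a => fmap U (eps (F a))) adj_join_nat.

Lemma adj_join_retl (a : C) :
  adj_join a \c eta ((U \F F) a) = idm ((U \F F) a).
Proof. exact: triangle_radj. Qed.

Lemma adj_join_retr (a : C) :
  adj_join a \c fmap (U \F F) (eta a) = idm ((U \F F) a).
Proof. by rewrite /= -fmapM triangle_ladj fmap1. Qed.

Lemma adj_joinA (a : C) :
  adj_join a \c fmap (U \F F) (adj_join a) =
  adj_join a \c adj_join ((U \F F) a).
Proof.
by rewrite /= -!fmapM; congr fmap; rewrite -(naturality eps (eps (F a))).
Qed.

Definition adj_monad : monad C :=
  @Monad C (U \F F) eta adj_join adj_join_retl adj_join_retr adj_joinA.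

Lemma comparison_mult (d : D) :
  fmap U (eps d) \c join adj_monad (U d) =
  fmap U (eps d) \c fmap adj_monad (fmap U (eps d)).
Proof.
by rewrite /= -!fmapM; congr fmap; rewrite -(naturality eps (eps d)).
Qed.

Definition comparison_obj (d : D) : EM_category adj_monad :=
  @Algebra C adj_monad (U d) (fmap U (eps d)) (triangle_radj A d)
    (comparison_mult d).

Lemma comparison_mapP (d e : D) (f : hom d e) :
  fmap U f \c alg_act (comparison_obj d) =
  alg_act (comparison_obj e) \c fmap adj_monad (fmap U f).
Proof. by rewrite /= -!fmapM; congr fmap; exact: (naturality eps f). Qed.

Definition comparison_map (d e : D) (f : hom d e) :
  hom (comparison_obj d) (comparison_obj e) :=
  @AlgHom C adj_monad (comparison_obj d) (comparison_obj e) (fmap U f)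
    (comparison_mapP f).

Lemma comparison_map1 (d : D) : comparison_map (idm d) = idm (comparison_obj d).
Proof. by apply: alg_hom_inj; exact: fmap1. Qed.

Lemma comparison_mapM (d e k : D) (g : hom e k) (f : hom d e) :
  comparison_map (g \c f) = comparison_map g \c comparison_map f.
Proof. by apply: alg_hom_inj; exact: fmapM. Qed.

Definition comparison : functor D (EM_category adj_monad) :=
  @Functor D (EM_category adj_monad) comparison_obj comparison_map
    comparison_map1 comparison_mapM.

Definition is_monadic : Prop := is_equivalence comparison.

End Comparison.

Definition monadic_over (D C : category) : Prop :=
  exists A : adjunction C D, is_monadic A.

(* A zmodType also carries a
   choice operator on its carrier; morphisms ignore it, and every type has one
   by the classical axioms. *)

Record qoGroup := QoGroup {
  qo_group :> zmodType;
  qo_le : qo_group -> qo_group -> Prop;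
  qo_le_refl : forall a, qo_le a a;
  qo_le_trans : forall a b c, qo_le a b -> qo_le b c -> qo_le a c;
  qo_leD2r : forall c a b, qo_le a b -> qo_le (a + c) (b + c) }.

Record qoHom (G H : qoGroup) := QoHom {
  qo_map :> {additive G -> H};
  qo_map_le : forall a b : G, qo_le a b -> qo_le (qo_map a) (qo_map b) }.

Lemma qoHom_eqP (G H : qoGroup) (f g : qoHom G H) : f =1 g -> f = g.
Proof.
case: f g => [[f [[fP]]] fle] [[g [[gP]]] gle] /= /funext fg; subst g.
rewrite (Prop_irrelevance gP fP) in gle *.
by rewrite (Prop_irrelevance gle fle).
Qed.

Definition qoHom_id (G : qoGroup) : qoHom G G :=
  @QoHom G G idfun (fun _ _ => id).

Definition qoHom_comp (G H K : qoGroup) (g : qoHom H K) (f : qoHom G H) :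
  qoHom G K :=
  @QoHom G K (g \o f) (fun a b ab => qo_map_le g (qo_map_le f ab)).

Lemma qoHom_compA (G H K L : qoGroup)
    (h : qoHom K L) (g : qoHom H K) (f : qoHom G H) :
  qoHom_comp h (qoHom_comp g f) = qoHom_comp (qoHom_comp h g) f.
Proof. exact: qoHom_eqP. Qed.

Lemma qoHom_comp1m (G H : qoGroup) (f : qoHom G H) :
  qoHom_comp (qoHom_id H) f = f.
Proof. exact: qoHom_eqP. Qed.

Lemma qoHom_compm1 (G H : qoGroup) (f : qoHom G H) :
  qoHom_comp f (qoHom_id G) = f.
Proof. exact: qoHom_eqP. Qed.

Definition QAb : category :=
  @Category qoGroup qoHom qoHom_id qoHom_comp
    qoHom_compA qoHom_comp1m qoHom_compm1.

Record setMono := SetMono {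
  mono_dom : Type;
  mono_cod : Type;
  mono_map :> mono_dom -> mono_cod;
  mono_inj : injective mono_map }.

Record setMonoHom (i j : setMono) := SetMonoHom {
  map_cod : mono_cod i -> mono_cod j;
  map_dom : mono_dom i -> mono_dom j;
  map_comm : j \o map_dom = map_cod \o i }.

Lemma setMonoHom_eq (i j : setMono) (f g : setMonoHom i j) :
  map_cod f = map_cod g -> map_dom f = map_dom g -> f = g.
Proof.
case: f g => [f1 f2 fP] [g1 g2 gP] /= fg1 fg2; subst g1 g2.
by rewrite (Prop_irrelevance fP gP).
Qed.

Definition setMonoHom_id (i : setMono) : setMonoHom i i :=
  @SetMonoHom i i id id erefl.

Lemma setMonoHom_compP (i j k : setMono)
    (g : setMonoHom j k) (f : setMonoHom i j) :
  k \o (map_dom g \o map_dom f) = (map_cod g \o map_cod f) \o i.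
Proof.
rewrite -[LHS]/((k \o map_dom g) \o map_dom f) map_comm.
by rewrite -[LHS]/(map_cod g \o (j \o map_dom f)) map_comm.
Qed.

Definition setMonoHom_comp (i j k : setMono)
    (g : setMonoHom j k) (f : setMonoHom i j) : setMonoHom i k :=
  SetMonoHom (setMonoHom_compP g f).

Lemma setMonoHom_compA (i j k l : setMono)
    (h : setMonoHom k l) (g : setMonoHom j k) (f : setMonoHom i j) :
  setMonoHom_comp h (setMonoHom_comp g f) =
  setMonoHom_comp (setMonoHom_comp h g) f.
Proof. exact: setMonoHom_eq. Qed.

Lemma setMonoHom_comp1m (i j : setMono) (f : setMonoHom i j) :
  setMonoHom_comp (setMonoHom_id j) f = f.
Proof. exact: setMonoHom_eq. Qed.

Lemma setMonoHom_compm1 (i j : setMono) (f : setMonoHom i j) :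
  setMonoHom_comp f (setMonoHom_id i) = f.
Proof. exact: setMonoHom_eq. Qed.

Definition SetM : category :=
  @Category setMono setMonoHom setMonoHom_id setMonoHom_comp
    setMonoHom_compA setMonoHom_comp1m setMonoHom_compm1.

(* Main.v *)
From HB Require Import structures.
From mathcomp Require Import all_boot all_algebra.
From mathcomp Require Import boolp freeg.
Require Import Defs.

Set Implicit Arguments.
Unset Strict Implicit.
Unset Printing Implicit Defensive.
Import GRing.Theory.
Local Open Scope ring_scope.
Local Open Scope cat_scope.

(** Translation invariance makes the quasi-order of an abelian qo-group G
    equivalent to its cone of elements a with 0 <= a, a submonoid, since
    a <= b iff 0 <= b - a. Hence G is the same thing as an abelian group with
    a distinguished submonoid, and the right adjoint sends it to the inclusion
    of the cone into G ([cone_functor]). Its left adjoint sends i : X' -> X to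
    the free abelian group on X whose cone is the submonoid generated by the
    elements of i(X') ([free_functor]): this is the least cone for which the
    unit is a morphism of monomorphisms.

    An equivalence is obtained from a comparison functor that is fully faithful
    and essentially surjective ([is_equivalence_ff_es]).

    - Fully faithful: a morphism of algebras between two cones is a map which
      commutes with the evaluation of formal Z-linear combinations, hence is
      additive (evaluate the combination [a] - [b]), and the existence of its
      component on domains says that it preserves the cones
      ([comparison_fully_faithful]).

    - Essentially surjective: for an algebra on i : X' -> X, the structure map
      v from the free abelian group on X to X is split by the generators, and
      associativity of the action says that v(u + w) depends on v(u) and v(w)
      alone. So the group structure descends along v. The structure map sends
      the free cone into i(X'), so i(X') contains 0 and is stable under
      addition: it is the cone of a qo-group on X, and v, being additive and
      the identity on generators, is the evaluation map of that group. As i is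
      injective, X' is in bijection with this cone, so the algebra comes from
      the qo-group ([comparison_essentially_surjective]). Injectivity matters
      here: otherwise X' would carry more information than its image. *)

(** * Recognizing equivalences *)

Definition fully_faithful (C D : category) (F : functor C D) : Prop :=
  forall a b : C, bijective (@fmap C D F a b).

Definition essentially_surjective (C D : category) (F : functor C D) : Prop :=
  forall d : D, exists c (e : hom (F c) d), is_iso e.

Lemma fully_faithful_iso (C D : category) (F : functor C D) (a b : C)
    (f : hom a b) :
  fully_faithful F -> is_iso (fmap F f) -> is_iso f.
Proof.
move=> FF [g [gf fg]]; have [r _ rK] := FF b a.
have [[s sK _] [t tK _]] := (FF a a, FF b b).
by exists (r g); split; [apply: (can_inj sK)|apply: (can_inj tK)];
  rewrite fmapM rK fmap1.
Qed.

(** The quasi-inverse picks, for each object d, an object whose image is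
    isomorphic to d, and transports morphisms along these isomorphisms. *)
Lemma is_equivalence_ff_es (C D : category) (F : functor C D) :
  fully_faithful F -> essentially_surjective F -> is_equivalence F.
Proof.
move=> FF ES.
have inj a b : injective (@fmap C D F a b) by exact: bij_inj (FF a b).
pose Go d := sval (cid (ES d)).
pose e d : hom (F (Go d)) d := sval (cid (svalP (cid (ES d)))).
have eI d : is_iso (e d) := svalP (cid (svalP (cid (ES d)))).
pose e' d := sval (cid (eI d)).
have [e'K eK] : (forall d, e' d \c e d = idm (F (Go d))) /\
    (forall d, e d \c e' d = idm d).
  by split=> d; have [] := svalP (cid (eI d)).
clearbody e'.
have lift a b : {r | cancel r (@fmap C D F a b)}.
  by apply: cid; have [r _ rK] := FF a b; exists r.
pose Gm a b (f : hom a b) := sval (lift (Go a) (Go b)) (e' b \c f \c e a).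
have GmE a b (f : hom a b) : fmap F (Gm a b f) = e' b \c f \c e a.
  exact: svalP (lift _ _) _.
have Gm1 d : Gm d d (idm d) = idm (Go d).
  by apply: inj; rewrite GmE fmap1 compm1 e'K.
have GmM a b c (g : hom b c) (f : hom a b) :
    Gm a c (g \c f) = Gm b c g \c Gm a b f.
  apply: inj; rewrite fmapM !GmE -!compmA; congr (_ \c (_ \c _)).
  by rewrite (compmA (e b)) eK comp1m.
pose G := Functor Gm1 GmM.
(* The components of the isomorphism from G \F F to the identity are the
   preimages under F of those of the isomorphism e from F \F G. *)
pose u c := sval (lift (Go (F c)) c) (e (F c)).
have uE c : fmap F (u c) = e (F c) by exact: svalP (lift _ _) _.
exists G; split.
- have uN a b (f : hom a b) : f \c u a = u b \c Gm _ _ (fmap F f).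
    by apply: inj; rewrite !fmapM !uE GmE !compmA eK comp1m.
  exists (@NatTrans _ _ (G \F F) (id_functor C) u uN) => c.
  by apply: fully_faithful_iso FF _; rewrite /= uE; exact: eI.
- have eN a b (f : hom a b) : f \c e a = e b \c fmap F (Gm _ _ f).
    by rewrite GmE !compmA eK comp1m.
  exists (@NatTrans _ _ (F \F G) (id_functor D) e eN) => d.
  exact: eI.
Qed.

(** The inverse of an algebra morphism in the base category is automatically
    an algebra morphism. *)
Lemma alg_is_iso (C : category) (T : monad C) (A B : EM_category T)
    (f : hom A B) :
  is_iso (alg_map f) -> is_iso f.
Proof.
move=> [g [gf fg]].
have gP : g \c alg_act B = alg_act A \c fmap T g.
  rewrite -[LHS]compm1 -(fmap1 T) -fg fmapM compmA -(compmA g) -alg_mapP.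
  by rewrite !compmA gf comp1m.
by exists (AlgHom gP); split; apply: alg_hom_inj.
Qed.

(** * Free abelian groups *)

Section FreeAbelianGroup.
Variable X : Type.

Definition free_ab : zmodType := {freeg {classic X}}.

Definition free_gen (x : X) : free_ab := << (x : {classic X}) >>.

(** [fglift] takes values in modules, and [zmodule M] is M seen as a module
    over the integers. *)
Definition free_lift_fun (M : zmodType) (f : X -> M) (v : free_ab) : M :=
  fglift (f : {classic X} -> zmodule M) v.

Lemma free_lift_is_additive (M : zmodType) (f : X -> M) :
  zmod_morphism (free_lift_fun f).
Proof. by move=> u v; exact: (lift_is_additive (f : {classic X} -> zmodule M)). Qed.

HB.instance Definition _ (M : zmodType) (f : X -> M) :=
  GRing.isZmodMorphism.Build free_ab M (free_lift_fun f)
    (free_lift_is_additive f).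

Definition free_lift (M : zmodType) (f : X -> M) : {additive free_ab -> M} :=
  free_lift_fun f.

Lemma free_lift_gen (M : zmodType) (f : X -> M) (x : X) :
  free_lift f (free_gen x) = f x.
Proof. by rewrite /= /free_lift_fun liftU scale1r. Qed.

Lemma free_ext (M : zmodType) (f g : {additive free_ab -> M}) :
  (forall x, f (free_gen x) = g (free_gen x)) -> f =1 g.
Proof.
move=> fg v; rewrite -(freeg_sumE v) !raddf_sum; apply: eq_bigr => x _.
by rewrite -[coeff x v]intz -freegU_mulz !raddfMz fg.
Qed.

End FreeAbelianGroup.

(** * The forgetful functor *)

Lemma qo_le_sub (G : qoGroup) (a b : G) : qo_le a b <-> qo_le 0 (b - a).
Proof.
split=> [/(qo_leD2r (- a))|/(qo_leD2r a)]; first by rewrite subrr.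
by rewrite add0r subrK.
Qed.

Lemma qo_ge0D (G : qoGroup) (a b : G) :
  qo_le 0 a -> qo_le 0 b -> qo_le 0 (a + b).
Proof.
by move=> a0 /(qo_leD2r a); rewrite add0r addrC; exact: qo_le_trans.
Qed.

Lemma qo_ge0_sum (G : qoGroup) (I : Type) (s : seq I) (f : I -> G) :
  (forall x, qo_le 0 (f x)) -> qo_le 0 (\sum_(x <- s) f x).
Proof.
by move=> f0; elim/big_ind: _ => [|a b|//]; [exact: qo_le_refl|exact: qo_ge0D].
Qed.

Lemma additive_qo_le (G H : qoGroup) (f : {additive G -> H}) :
  (forall a, qo_le 0 a -> qo_le 0 (f a)) ->
  forall a b, qo_le a b -> qo_le (f a) (f b).
Proof. by move=> f0 a b /qo_le_sub/f0; rewrite raddfB; move=> ?; apply/qo_le_sub. Qed.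

Lemma map_domE (i j : setMono) (f : setMonoHom i j) (x : mono_dom i) :
  j (map_dom f x) = map_cod f (i x).
Proof. by rewrite -[LHS]/((j \o map_dom f) x) map_comm. Qed.

(** As the target is injective, the map on domains is determined by the map on
    codomains, so all equations between morphisms below are checked on
    codomains only. *)
Lemma setMonoHom_eq_cod (i j : setMono) (f g : setMonoHom i j) :
  map_cod f =1 map_cod g -> f = g.
Proof.
move=> /funext fg; apply: setMonoHom_eq => //; apply: funext => x.
by apply: (@mono_inj j); rewrite !map_domE fg.
Qed.

(** The equations of adjunctions and algebras are stated in the abstract
    category; this gives their pointwise content. *)
Lemma map_cod_congr (i j : SetM) (f g : hom i j) :
  f = g -> forall x, map_cod f x = map_cod g x.
Proof. by move=> ->. Qed.

Section Cone.
Variable G : qoGroup.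

Definition cone_dom : Type := {a : G | qo_le 0 a}.

Lemma cone_inj : injective (fun a : cone_dom => sval a).
Proof. by move=> [a ?] [b ?]; exact: eq_exist. Qed.

Definition cone : SetM := SetMono cone_inj.

End Cone.

Lemma to_cone_subproof (i : setMono) (G : qoGroup) (f : mono_cod i -> G)
    (f0 : forall x, qo_le 0 (f (i x))) :
  cone G \o (fun x => exist _ (f (i x)) (f0 x)) = f \o i.
Proof. by []. Qed.

Definition to_cone (i : setMono) (G : qoGroup) (f : mono_cod i -> G)
    (f0 : forall x, qo_le 0 (f (i x))) : hom (i : SetM) (cone G) :=
  SetMonoHom (to_cone_subproof f0).

Lemma cone_map_ge0 (G H : qoGroup) (f : qoHom G H) (a : cone_dom G) :
  qo_le 0 (f (sval a)).
Proof. by rewrite -(raddf0 (qo_map f)); exact: qo_map_le (svalP a). Qed.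

Definition cone_map (G H : qoGroup) (f : qoHom G H) : hom (cone G) (cone H) :=
  @to_cone (cone G) H f (cone_map_ge0 f).

Lemma cone_map1 (G : qoGroup) : cone_map (qoHom_id G) = idm (cone G).
Proof. exact: setMonoHom_eq_cod. Qed.

Lemma cone_mapM (G H K : qoGroup) (g : qoHom H K) (f : qoHom G H) :
  cone_map (qoHom_comp g f) = cone_map g \c cone_map f.
Proof. exact: setMonoHom_eq_cod. Qed.

Definition cone_functor : functor QAb SetM :=
  @Functor QAb SetM cone cone_map cone_map1 cone_mapM.

Lemma qoHom_compE (G H K : qoGroup) (g : qoHom H K) (f : qoHom G H) (a : G) :
  qoHom_comp g f a = g (f a).
Proof. by []. Qed.

(** * The free abelian quasi-ordered group of a set monomorphism *)

Section FreeQoGroup.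
Variable i : setMono.
Notation Z := (free_ab (mono_cod i)).

(** The submonoid generated by the image of i: the repetitions in s account for
    the natural coefficients. *)
Definition free_cone (v : Z) : Prop :=
  exists s : seq (mono_dom i), v = \sum_(x <- s) free_gen (i x).

Definition free_le (u v : Z) : Prop := free_cone (v - u).

Lemma free_le_refl u : free_le u u.
Proof. by exists [::]; rewrite big_nil subrr. Qed.

Lemma free_le_trans u v w : free_le u v -> free_le v w -> free_le u w.
Proof.
by move=> [s sE] [t tE]; exists (t ++ s); rewrite big_cat /= -sE -tE subrKA.
Qed.

Lemma free_leD2r w u v : free_le u v -> free_le (u + w) (v + w).
Proof. by rewrite /free_le opprD addrACA subrr addr0. Qed.

Definition free_qo : qoGroup := QoGroup free_le_refl free_le_trans free_leD2r.

Lemma free_gen_ge0 (x : mono_dom i) : @qo_le free_qo 0 (free_gen (i x)).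
Proof. by exists [:: x]; rewrite big_seq1 subr0. Qed.

Definition free_unit : hom (i : SetM) (cone free_qo) :=
  to_cone (G := free_qo) free_gen_ge0.

Lemma free_qo_lift_le (G : qoGroup) (f : setMonoHom i (cone G)) (a b : free_qo) :
  qo_le a b -> qo_le (free_lift (map_cod f) a) (free_lift (map_cod f) b).
Proof.
move=> /= [s sE]; apply/qo_le_sub; rewrite -raddfB sE raddf_sum.
apply: qo_ge0_sum => x; rewrite free_lift_gen -map_domE.
exact: svalP (map_dom f x).
Qed.

Definition free_qo_lift (G : qoGroup) (f : hom (i : SetM) (cone G)) :
    qoHom free_qo G :=
  @QoHom free_qo G _ (free_qo_lift_le f).

Lemma free_qo_lift_gen (G : qoGroup) (f : hom (i : SetM) (cone G)) x :
  free_qo_lift f (free_gen x) = map_cod f x.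
Proof. exact: free_lift_gen. Qed.

Lemma free_qo_ext (G : qoGroup) (f g : qoHom free_qo G) :
  (forall x, f (free_gen x) = g (free_gen x)) -> f = g.
Proof. by move=> fg; apply: qoHom_eqP; exact: free_ext. Qed.

End FreeQoGroup.

Definition free_map (i j : setMono) (f : setMonoHom i j) :
    qoHom (free_qo i) (free_qo j) :=
  free_qo_lift (free_unit j \c (f : hom (i : SetM) j)).

Lemma free_map_gen (i j : setMono) (f : setMonoHom i j) x :
  free_map f (free_gen x) = free_gen (map_cod f x).
Proof. exact: free_qo_lift_gen. Qed.

Lemma free_map1 (i : setMono) : free_map (setMonoHom_id i) = qoHom_id _.
Proof. by apply: free_qo_ext => x; rewrite free_map_gen. Qed.

Lemma free_mapM (i j k : setMono) (g : setMonoHom j k) (f : setMonoHom i j) :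
  free_map (setMonoHom_comp g f) = qoHom_comp (free_map g) (free_map f).
Proof. by apply: free_qo_ext => x; rewrite qoHom_compE !free_map_gen. Qed.

Definition free_functor : functor SetM QAb :=
  @Functor SetM QAb free_qo free_map free_map1 free_mapM.

(** * The adjunction *)

Definition free_counit (G : qoGroup) : qoHom (free_qo (cone G)) G :=
  free_qo_lift (idm (cone G)).

Lemma free_counit_gen (G : qoGroup) (a : G) :
  free_counit G (free_gen (a : mono_cod (cone G))) = a.
Proof. exact: free_qo_lift_gen. Qed.

Lemma free_unit_nat (i j : SetM) (f : hom i j) :
  fmap (cone_functor \F free_functor) f \c free_unit i = free_unit j \c f.
Proof. by apply: setMonoHom_eq_cod => x; exact: free_map_gen. Qed.

Lemma free_counit_nat (G H : QAb) (f : hom G H) :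
  f \c (free_counit G : hom (free_functor (cone G) : QAb) G) =
  (free_counit H : hom (free_functor (cone H) : QAb) H)
    \c fmap (free_functor \F cone_functor) f.
Proof.
apply: free_qo_ext => x; rewrite [LHS]qoHom_compE [RHS]qoHom_compE.
by rewrite free_map_gen !free_counit_gen.
Qed.

Lemma free_triangle (i : SetM) :
  qoHom_comp (free_counit (free_qo i)) (free_map (free_unit i)) = qoHom_id _.
Proof.
by apply: free_qo_ext => x; rewrite qoHom_compE free_map_gen free_counit_gen.
Qed.

Lemma cone_triangle (G : QAb) :
  cone_map (free_counit G) \c free_unit (cone G) = idm (cone G).
Proof. by apply: setMonoHom_eq_cod => x; exact: free_counit_gen. Qed.

Definition free_cone_adjunction : adjunction SetM QAb :=
  @Adjunction SetM QAb free_functor cone_functor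
    (@NatTrans _ _ (id_functor SetM) (cone_functor \F free_functor)
      free_unit free_unit_nat)
    (@NatTrans _ _ (free_functor \F cone_functor) (id_functor QAb)
      free_counit free_counit_nat)
    free_triangle cone_triangle.

Notation FC := (comparison free_cone_adjunction).
Notation FCmonad := (adj_monad free_cone_adjunction).

(** * The comparison functor is fully faithful *)

Section AlgebraMaps.
Variables (G H : QAb) (h : hom (FC G) (FC H)).

Let hf : G -> H := map_cod (alg_map h).

(** For the algebra of a qo-group, the action is the counit, that is, the
    evaluation of formal sums; a morphism commutes with it. *)
Lemma alg_map_counit (w : free_qo (cone G)) :
  hf (free_counit G w) = free_counit H (free_map (alg_map h) w).
Proof. exact: (map_cod_congr (alg_mapP h) w). Qed.

Lemma alg_map_is_additive : zmod_morphism hf.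
Proof.
move=> a b.
have := alg_map_counit (free_gen (a : mono_cod (cone G)) - free_gen b).
by rewrite !raddfB !free_map_gen !free_counit_gen.
Qed.

HB.instance Definition _ :=
  GRing.isZmodMorphism.Build G H hf alg_map_is_additive.

(** The value of h at an element of the cone is the image of an element of the
    cone of H, given by the map on domains. *)
Lemma alg_map_ge0 (a : G) : qo_le 0 a -> qo_le 0 (hf a).
Proof.
move=> a0; rewrite -[hf a](map_domE (alg_map h) (exist _ a a0)).
exact: (svalP (map_dom (alg_map h) (exist _ a a0) : cone_dom H)).
Qed.

Definition qoHom_of_alg_hom : hom G H := QoHom (additive_qo_le alg_map_ge0).

Lemma qoHom_of_alg_homK : fmap FC qoHom_of_alg_hom = h.
Proof. by apply: alg_hom_inj; exact: setMonoHom_eq_cod. Qed.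

End AlgebraMaps.

Lemma comparison_fully_faithful : fully_faithful FC.
Proof.
move=> G H; exists (@qoHom_of_alg_hom G H); last exact: qoHom_of_alg_homK.
by move=> f; exact: qoHom_eqP.
Qed.

(** * The quasi-ordered group of an algebra *)

Section AlgebraGroup.
Variable A : EM_category FCmonad.

(** The carrier is the codomain of the algebra under a new name, to which the
    group structure can be attached; [{classic _}] provides the choice operator
    that a [zmodType] requires. *)
Definition alg_car : Type := {classic mono_cod (alg_obj A)}.

HB.instance Definition _ := Choice.on alg_car.

Let X : setMono := alg_obj A.
Definition alg_val : free_qo X -> alg_car := map_cod (alg_act A).
Definition alg_gen : alg_car -> free_qo X := @free_gen (mono_cod X).

Lemma alg_genK : cancel alg_gen alg_val.
Proof. by move=> x; exact: (map_cod_congr (alg_unit A) x). Qed.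

(** Associativity of the action: for a formal sum w of formal sums, flattening
    and evaluating agrees with evaluating inside and then outside. *)
Lemma alg_val_join (w : free_qo (cone (free_qo X))) :
  alg_val (free_counit (free_qo X) w) = alg_val (free_map (alg_act A) w).
Proof. exact: (map_cod_congr (alg_mult A) w). Qed.

Definition alg_zero : alg_car := alg_val 0.
Definition alg_opp (x : alg_car) : alg_car := alg_val (- alg_gen x).
Definition alg_add (x y : alg_car) : alg_car :=
  alg_val (alg_gen x + alg_gen y).

(** Flatten the formal sums - [u] and [u] + [v]. *)
Lemma alg_valN u : alg_val (- u) = alg_opp (alg_val u).
Proof.
have := alg_val_join (- free_gen (u : mono_cod (cone (free_qo X)))).
by rewrite !raddfN free_map_gen free_counit_gen.
Qed.

Lemma alg_valD u v : alg_val (u + v) = alg_add (alg_val u) (alg_val v).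
Proof.
have := alg_val_join (free_gen (u : mono_cod (cone (free_qo X))) + free_gen v).
by rewrite !raddfD !free_map_gen !free_counit_gen.
Qed.

(** Each group axiom holds because every element is the value of a generator
    and [alg_val] transports the operations of the free abelian group. *)
Lemma alg_addA : associative alg_add.
Proof.
move=> x y z; rewrite -(alg_genK x) -(alg_genK y) -(alg_genK z).
by rewrite -!alg_valD addrA.
Qed.

Lemma alg_addC : commutative alg_add.
Proof. by move=> x y; rewrite /alg_add addrC. Qed.

Lemma alg_add0 : left_id alg_zero alg_add.
Proof. by move=> x; rewrite -(alg_genK x) -alg_valD add0r. Qed.

Lemma alg_addN : left_inverse alg_zero alg_opp alg_add.
Proof. by move=> x; rewrite -(alg_genK x) -alg_valN -alg_valD addNr. Qed.

HB.instance Definition _ :=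
  GRing.isZmodule.Build alg_car alg_addA alg_addC alg_add0 alg_addN.

Lemma alg_val_is_additive : zmod_morphism alg_val.
Proof. by move=> u v; rewrite alg_valD alg_valN. Qed.

HB.instance Definition _ :=
  GRing.isZmodMorphism.Build (free_qo X) alg_car alg_val alg_val_is_additive.

Definition alg_cone (x : alg_car) : Prop := exists x' : mono_dom X, X x' = x.

(** The component of the action on domains sends the free cone to the domain of
    the algebra; closure of [alg_cone] under 0 and addition follows. *)
Lemma alg_val_cone (u : free_qo X) : qo_le 0 u -> alg_cone (alg_val u).
Proof.
move=> u0; exists (map_dom (alg_act A) (exist _ u u0)).
by rewrite map_domE.
Qed.

Definition alg_le (x y : alg_car) : Prop := alg_cone (y - x).

Lemma alg_le_refl x : alg_le x x.
Proof.
rewrite /alg_le subrr -(raddf0 alg_val).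
exact/alg_val_cone/qo_le_refl.
Qed.

Lemma alg_le_trans x y z : alg_le x y -> alg_le y z -> alg_le x z.
Proof.
move=> [x' x'E] [y' y'E]; rewrite /alg_le -(subrKA y) -x'E -y'E.
by apply: alg_val_cone; apply: qo_ge0D; exact: free_gen_ge0.
Qed.

Lemma alg_leD2r z x y : alg_le x y -> alg_le (x + z) (y + z).
Proof. by rewrite /alg_le opprD addrACA subrr addr0. Qed.

Definition alg_qo : qoGroup := QoGroup alg_le_refl alg_le_trans alg_leD2r.

Lemma alg_qo_ge0 (x : alg_qo) : qo_le 0 x <-> alg_cone x.
Proof. by rewrite /= /alg_le subr0. Qed.

Lemma alg_to_cone_ge0 (x' : mono_dom X) : @qo_le alg_qo 0 (X x').
Proof. by apply/alg_qo_ge0; exists x'. Qed.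

Definition alg_to_cone : hom (X : SetM) (cone alg_qo) :=
  @to_cone X alg_qo id alg_to_cone_ge0.

(** The algebra structure and the evaluation map of [alg_qo] are additive maps
    on the same free abelian group, and both are the identity on generators. *)
Lemma alg_to_coneP :
  alg_to_cone \c alg_act A =
  alg_act (FC alg_qo) \c fmap FCmonad alg_to_cone.
Proof.
apply: setMonoHom_eq_cod => w.
apply: (@free_ext _ alg_qo alg_val
  (free_counit alg_qo \o free_map alg_to_cone)) => x.
rewrite -[RHS]/(free_counit alg_qo (free_map alg_to_cone (free_gen x))).
by rewrite free_map_gen free_counit_gen; exact: alg_genK.
Qed.

(** A preimage of an element of the cone is unique since the monomorphism is
    injective; choosing it gives the inverse on domains. *)
Lemma alg_to_cone_iso : is_iso alg_to_cone.
Proof.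
have s (a : cone_dom alg_qo) : {x' | X x' = sval a}.
  by apply: cid; have /alg_qo_ge0 := svalP a.
have gP : X \o (fun a => sval (s a)) = id \o cone alg_qo.
  by apply: funext => a; exact: svalP (s a).
exists (SetMonoHom (i := cone alg_qo) gP).
by split; exact: setMonoHom_eq_cod.
Qed.

End AlgebraGroup.

Lemma comparison_essentially_surjective : essentially_surjective FC.
Proof.
move=> A; exists (alg_qo A).
pose k : hom A (FC (alg_qo A)) :=
  @AlgHom _ FCmonad A (FC (alg_qo A)) (alg_to_cone A) (alg_to_coneP A).
have [g [gk kg]] : is_iso k by exact/alg_is_iso/alg_to_cone_iso.
by exists g, k.
Qed.

Theorem theorem5p6 : monadic_over QAb SetM.
Proof.
exists free_cone_adjunction; apply: is_equivalence_ff_es.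
- exact: comparison_fully_faithful.
- exact: comparison_essentially_surjective.
Qed.
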